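(* Let $\mathcal{K}=(\mathcal{A},g,\{x^1,\dots,x^m\})$ and $\mathcal{K}'=(\mathcal{A}',g',\{y^1,\dots,y^{m'}\})$ be Kähler-Poisson algebras, with $\eta\in\mathcal{A}$ and $\eta'\in\mathcal{A}'$ such that $$\sum_{i,j,k,l=1}^m\eta\{a_1,x^i\}g_{ij}\{x^j,x^k\}g_{kl}\{x^l,b_1\}=-\{a_1,b_1\}\quad\text{for all } a_1,b_1\in\mathcal{A}$$ and $$\sum_{\alpha,\beta,\gamma,\delta=1}^{m'}\eta'\{a_2,y^\alpha\}'g'_{\alpha\beta}\{y^\beta,y^\gamma\}'g'_{\gamma\delta}\{y^\delta,b_2\}'=-\{a_2,b_2\}'\quad\text{for all } a_2,b_2\in\mathcal{A}'.$$ Assume that there exist $\rho\in\mathcal{A}$ and $\rho'\in\mathcal{A}'$ such that $\rho^2=\eta$ and $\rho'^2=\eta'$. Set $\mathcal{K}\otimes\mathcal{K}'=(\mathcal{A}\otimes\mathcal{A}',\tilde g,\{z^1,\dots,z^{m+m'}\})$ where $$z^I=\begin{cases}x^I\otimes 1&\text{if } I\in\{1,\dots,m\}\\1\otimes y^{I-m}&\text{if } I\in\{m+1,\dots,m+m'\},\end{cases}$$ and $$\tilde g_{IJ}=\begin{cases}\rho g_{IJ}\otimes 1&\text{if } I,J\in\{1,\dots,m\}\\1\otimes\rho' g'_{I-m,J-m}&\text{if } I,J\in\{m+1,\dots,m+m'\}\\0&\text{otherwise.}\end{cases}$$ Then $\mathcal{K}\otimes\mathcal{K}'$ is a Kähler-Poisson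 algebra.
   Context: Let $\mathbb{K}$ be $\mathbb{R}$ or $\mathbb{C}$. Poisson algebras here are unital commutative associative algebras over $\mathbb{K}$ with a Lie bracket satisfying the Leibniz rule. The bracket of $\mathcal{A}$ is $\{\cdot,\cdot\}$, that of $\mathcal{A}'$ is $\{\cdot,\cdot\}'$. A Kähler-Poisson algebra is a triple $\mathcal{K}=(\mathcal{A},g,\{x^1,\dots,x^m\})$ where $(\mathcal{A},\{\cdot,\cdot\})$ is a Poisson algebra over $\mathbb{K}$, $x^1,\dots,x^m\in\mathcal{A}$, and $g=(g_{ij})$ is a symmetric $m\times m$ matrix with entries in $\mathcal{A}$, such that there exists $\eta\in\mathcal{A}$ with $\sum_{i,j,k,l=1}^m \eta\{a,x^i\}g_{ij}\{x^j,x^k\}g_{kl}\{x^l,b\}=-\{a,b\}$ for all $a,b\in\mathcal{A}$. The tensor product $\mathcal{A}\otimes\mathcal{A}'$ (over $\mathbb{K}$) of Poisson algebras is a Poisson algebra with the usual product and the bracket determined by $\{a_1\otimes a_2,b_1\otimes b_2\}=\{a_1,b_1\}\otimes a_2b_2+a_1b_1\otimes\{a_2,b_2\}'$ for $a_1,b_1\in\mathcal{A}$, $a_2,b_2\in\mathcal{A}'$. *)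

(* Defs.v *)
From HB Require Import structures.
From mathcomp Require Import all_boot all_order all_algebra.
From mathcomp Require Import boolp reals complex.

Set Implicit Arguments.
Unset Strict Implicit.
Unset Printing Implicit Defensive.

Import GRing.Theory.
Local Open Scope ring_scope.
Local Open Scope quotient_scope.

(* The field R of real numbers (c = false) or C = R[i] (c = true). *)
Definition scalars (R : realType) (c : bool) : fieldType :=
  if c then (R[i] : fieldType) else (R : fieldType).

(* Unital commutative associative K-algebras. The library's comAlgType is not
   used because it excludes the zero algebra, and the scalar action is not
   taken from lmodType because the hierarchy has no join of pzRingType and
   lmodType. *)
HB.mixin Record ComPzRing_isAlgebra (K : fieldType) A
    of GRing.ComPzRing A := {
  pzscale : K -> A -> A;
  pzscaleA : forall (k l : K) (a : A),
    pzscale k (pzscale l a) = pzscale (k * l) a;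
  pzscale1 : forall a : A, pzscale 1 a = a;
  pzscaleDr : forall (k : K) (a b : A),
    pzscale k (a + b) = pzscale k a + pzscale k b;
  pzscaleDl : forall (k l : K) (a : A),
    pzscale (k + l) a = pzscale k a + pzscale l a;
  pzscaleAl : forall (k : K) (a b : A), pzscale k (a * b) = pzscale k a * b
}.

#[short(type="comPzAlgType")]
HB.structure Definition ComPzAlgebra (K : fieldType) :=
  {A of GRing.ComPzRing A & ComPzRing_isAlgebra K A}.

HB.mixin Record ComPzAlgebra_isPoisson (K : fieldType) A
    of ComPzAlgebra K A := {
  bracket : A -> A -> A;
  bracketDl : forall a b c : A, bracket (a + b) c = bracket a c + bracket b c;
  bracketDr : forall a b c : A, bracket a (b + c) = bracket a b + bracket a c;
  bracketZl : forall (k : K) (a b : A),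
    bracket (pzscale k a) b = pzscale k (bracket a b);
  bracketZr : forall (k : K) (a b : A),
    bracket a (pzscale k b) = pzscale k (bracket a b);
  bracketxx : forall a : A, bracket a a = 0;
  bracket_jacobi : forall a b c : A,
    bracket a (bracket b c) + bracket b (bracket c a)
      + bracket c (bracket a b) = 0;
  bracket_leibniz : forall a b c : A,
    bracket a (b * c) = bracket a b * c + b * bracket a c
}.

#[short(type="poissonAlgType")]
HB.structure Definition PoissonAlgebra (K : fieldType) :=
  {A of ComPzAlgebra K A & ComPzAlgebra_isPoisson K A}.

Notation "{[ a , b ]}" := (bracket a b)
  (at level 0, a at level 99, b at level 99, format "{[ a ,  b ]}")
  : ring_scope.

Section PoissonTheory.
Variables (K : fieldType) (A : poissonAlgType K).
Implicit Types (a b c : A) (k : K).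

Lemma pzscaler0 k : pzscale k (0 : A) = 0.
Proof. by apply: (addrI (pzscale k 0)); rewrite -pzscaleDr !addr0. Qed.

Lemma pzscale0r a : pzscale (0 : K) a = 0.
Proof. by apply: (addrI (pzscale 0 a)); rewrite -pzscaleDl !addr0. Qed.

Lemma pzscaleAr k a b : pzscale k (a * b) = a * pzscale k b.
Proof. by rewrite mulrC pzscaleAl mulrC. Qed.

Lemma bracketC a b : {[a, b]} = - {[b, a]}.
Proof.
apply/eqP; rewrite -addr_eq0; apply/eqP.
have := bracketxx (a + b).
by rewrite bracketDl !bracketDr !bracketxx add0r addr0.
Qed.

Lemma bracketr0 a : {[a, 0]} = 0.
Proof. by apply: (addrI {[a, 0]}); rewrite -bracketDr !addr0. Qed.

Lemma bracket0r a : {[0, a]} = 0.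
Proof. by rewrite bracketC bracketr0 oppr0. Qed.

Lemma bracketNr a b : {[a, - b]} = - {[a, b]}.
Proof.
by apply: (addrI {[a, b]}); rewrite -bracketDr !subrr bracketr0.
Qed.

Lemma bracketr1 a : {[a, 1]} = 0.
Proof.
apply: (addrI {[a, 1]}); rewrite addr0 -{3}[1]mulr1 bracket_leibniz.
by rewrite mulr1 mul1r.
Qed.

Lemma bracket1r a : {[1, a]} = 0.
Proof. by rewrite bracketC bracketr1 oppr0. Qed.

End PoissonTheory.

(* A tensor is a formal finite sum of pairs (a, b), up to the smallest
   congruence making (a, b) |-> [:: (a, b)] bilinear. *)
Section Tensor.
Variables (K : fieldType) (A B : poissonAlgType K).

Inductive tensor_eq : seq (A * B) -> seq (A * B) -> Prop :=
| tensor_eq_refl s : tensor_eq s s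
| tensor_eq_sym s t : tensor_eq s t -> tensor_eq t s
| tensor_eq_trans s t u : tensor_eq s t -> tensor_eq t u -> tensor_eq s u
| tensor_eq_cat s s' t t' :
    tensor_eq s s' -> tensor_eq t t' -> tensor_eq (s ++ t) (s' ++ t')
| tensor_eq_catC s t : tensor_eq (s ++ t) (t ++ s)
| tensor_eq_0 b : tensor_eq [:: (0, b)] [::]
| tensor_eq_Dl a a' b : tensor_eq [:: (a + a', b)] [:: (a, b); (a', b)]
| tensor_eq_Dr a b b' : tensor_eq [:: (a, b + b')] [:: (a, b); (a, b')]
| tensor_eq_Z k a b :
    tensor_eq [:: (pzscale k a, b)] [:: (a, pzscale k b)].

Definition tensor_eqb : rel (seq (A * B)) := fun s t => `[< tensor_eq s t >].

Lemma tensor_eqb_refl : reflexive tensor_eqb.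
Proof. by move=> s; apply/asboolP/tensor_eq_refl. Qed.

Lemma tensor_eqb_sym : symmetric tensor_eqb.
Proof. by move=> s t; apply/asboolP/asboolP => /tensor_eq_sym. Qed.

Lemma tensor_eqb_trans : transitive tensor_eqb.
Proof.
move=> t s u /asboolP st /asboolP tu; apply/asboolP.
exact: tensor_eq_trans st tu.
Qed.

Canonical tensor_equiv :=
  EquivRel tensor_eqb tensor_eqb_refl tensor_eqb_sym tensor_eqb_trans.

Definition tensor := {eq_quot tensor_equiv}.

HB.instance Definition _ := Choice.on tensor.
HB.instance Definition _ := EqQuotient.on tensor.

Definition pure (a : A) (b : B) : tensor := \pi_tensor [:: (a, b)].

Lemma tensor_piE s t : tensor_eq s t -> \pi_tensor s = \pi_tensor t.
Proof. by move=> st; apply/eqP; rewrite eqmodE; apply/asboolP. Qed.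

Lemma tensor_reprP s : tensor_eq (repr (\pi_tensor s)) s.
Proof. by apply/asboolP; rewrite -[asbool _]/(tensor_equiv _ _) -eqmodE reprK. Qed.

Definition tensor_add (x y : tensor) : tensor :=
  \pi_tensor (repr x ++ repr y).
Definition tensor_opp (x : tensor) : tensor :=
  \pi_tensor [seq (- u.1, u.2) | u <- repr x].

Lemma tensor_add_pi s t :
  tensor_add (\pi_tensor s) (\pi_tensor t) = \pi_tensor (s ++ t).
Proof. by apply: tensor_piE; apply: tensor_eq_cat; apply: tensor_reprP. Qed.

Lemma tensor_addA : associative tensor_add.
Proof.
move=> x y z; rewrite -[x]reprK -[y]reprK -[z]reprK.
move: (repr x) (repr y) (repr z) => s t u.
rewrite (tensor_add_pi t u) (tensor_add_pi s t).
by rewrite (tensor_add_pi s) (tensor_add_pi _ u) catA.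
Qed.

Lemma tensor_addC : commutative tensor_add.
Proof. by move=> x y; apply: tensor_piE; apply: tensor_eq_catC. Qed.

Lemma tensor_add0 : left_id (\pi_tensor [::]) tensor_add.
Proof. by move=> x; rewrite -[x]reprK tensor_add_pi. Qed.

Lemma tensor_addN : left_inverse (\pi_tensor [::]) tensor_opp tensor_add.
Proof.
move=> x; rewrite -{2}[x]reprK tensor_add_pi; apply: tensor_piE.
elim: (repr x) => [|[a b] s IHs] /=; first exact: tensor_eq_refl.
apply: (@tensor_eq_trans _ ([:: (- a, b); (a, b)]
    ++ ([seq (- u.1, u.2) | u <- s] ++ s))).
  rewrite -cat1s -[(a, b) :: s]cat1s -[[:: _; _]]/([:: (- a, b)] ++ [:: (a, b)]).
  rewrite -[(_ ++ _) ++ _]catA; apply: tensor_eq_cat; first exact: tensor_eq_refl.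
  by rewrite !catA; apply: tensor_eq_cat;
    [exact: tensor_eq_catC | exact: tensor_eq_refl].
rewrite -[[::]]/([::] ++ [::]); apply: tensor_eq_cat => //.
apply: (@tensor_eq_trans _ [:: (- a + a, b)]).
  exact/tensor_eq_sym/tensor_eq_Dl.
by rewrite addNr; apply: tensor_eq_0.
Qed.

HB.instance Definition _ :=
  GRing.isZmodule.Build tensor tensor_addA tensor_addC tensor_add0 tensor_addN.

Lemma pureDl a a' b : pure (a + a') b = pure a b + pure a' b.
Proof.
by rewrite /pure [RHS]tensor_add_pi; apply: tensor_piE; apply: tensor_eq_Dl.
Qed.

Lemma pureDr a b b' : pure a (b + b') = pure a b + pure a b'.
Proof.
by rewrite /pure [RHS]tensor_add_pi; apply: tensor_piE; apply: tensor_eq_Dr.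
Qed.

Lemma pureZ k a b : pure (pzscale k a) b = pure a (pzscale k b).
Proof. by apply: tensor_piE; apply: tensor_eq_Z. Qed.

Lemma pure0l b : pure 0 b = 0.
Proof. by apply: (addrI (pure 0 b)); rewrite -pureDl !addr0. Qed.

Lemma pure0r a : pure a 0 = 0.
Proof. by apply: (addrI (pure a 0)); rewrite -pureDr !addr0. Qed.

Lemma pureNl a b : pure (- a) b = - pure a b.
Proof. by apply: (addrI (pure a b)); rewrite -pureDl !subrr pure0l. Qed.

Lemma pureNr a b : pure a (- b) = - pure a b.
Proof. by apply: (addrI (pure a b)); rewrite -pureDr !subrr pure0r. Qed.

Lemma tensor_ind (P : tensor -> Prop) :
  P 0 -> (forall x y, P x -> P y -> P (x + y)) -> (forall a b, P (pure a b)) ->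
  forall x, P x.
Proof.
move=> P0 PD Pp x; rewrite -[x]reprK; elim: (repr x) => [|[a b] s IHs] //.
by rewrite -cat1s -(tensor_add_pi [:: (a, b)] s); apply: PD => //; apply: Pp.
Qed.

Section Lift.
Variables (V : zmodType) (f : A -> B -> V).

Definition balanced := [/\ forall a a' b, f (a + a') b = f a b + f a' b,
  forall a b b', f a (b + b') = f a b + f a b'
  & forall k a b, f (pzscale k a) b = f a (pzscale k b)].

Definition tensor_lift (x : tensor) : V := \sum_(u <- repr x) f u.1 u.2.

Hypothesis fB : balanced.

Lemma tensor_lift_pi s :
  tensor_lift (\pi_tensor s) = \sum_(u <- s) f u.1 u.2.
Proof.
rewrite /tensor_lift; move: (repr _) (tensor_reprP s) => t st.
case: fB => fDl fDr fZ; elim: st => //.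
- by move=> s1 s2 s3 _ -> _ ->.
- by move=> s1 s2 t1 t2 _ e1 _ e2; rewrite !big_cat /= e1 e2.
- by move=> s1 s2; rewrite !big_cat /= addrC.
- move=> b; rewrite big_seq1 big_nil /=.
  by apply: (addrI (f 0 b)); rewrite -fDl !addr0.
- by move=> a a' b; rewrite !big_cons !big_nil !addr0 /= fDl.
- by move=> a b b'; rewrite !big_cons !big_nil !addr0 /= fDr.
- by move=> k a b; rewrite !big_seq1 /= fZ.
Qed.

Lemma tensor_lift_pure a b : tensor_lift (pure a b) = f a b.
Proof. by rewrite tensor_lift_pi big_seq1. Qed.

Lemma tensor_liftD x y : tensor_lift (x + y) = tensor_lift x + tensor_lift y.
Proof.
rewrite -[x]reprK -[y]reprK [_ + _]tensor_add_pi.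
by rewrite !tensor_lift_pi big_cat.
Qed.

Lemma tensor_lift0 : tensor_lift 0 = 0.
Proof. by apply: (addrI (tensor_lift 0)); rewrite -tensor_liftD !addr0. Qed.

End Lift.

Section Lift2.
Variable f : A -> B -> A -> B -> tensor.

Definition balanced2 :=
  (forall a b, balanced (f a b)) /\ (forall c d, balanced (fun a b => f a b c d)).

Definition tensor_lift2 (x y : tensor) : tensor :=
  tensor_lift (fun a b => tensor_lift (f a b) y) x.

Hypothesis fB : balanced2.

Let balanced2_outer y : balanced (fun a b => tensor_lift (f a b) y).
Proof.
case: fB => fB1 fB2; split.
- move=> a a' b; elim/tensor_ind: y => [|y z IHy IHz|c d].
  + by rewrite !tensor_lift0 ?addr0.
  + by rewrite !tensor_liftD // IHy IHz addrACA.
  + by rewrite !tensor_lift_pure //; case: (fB2 c d).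
- move=> a b b'; elim/tensor_ind: y => [|y z IHy IHz|c d].
  + by rewrite !tensor_lift0 ?addr0.
  + by rewrite !tensor_liftD // IHy IHz addrACA.
  + by rewrite !tensor_lift_pure //; case: (fB2 c d).
- move=> k a b; elim/tensor_ind: y => [|y z IHy IHz|c d].
  + by rewrite !tensor_lift0.
  + by rewrite !tensor_liftD // IHy IHz.
  + by rewrite !tensor_lift_pure //; case: (fB2 c d).
Qed.

Lemma tensor_lift2Dl x y z :
  tensor_lift2 (x + y) z = tensor_lift2 x z + tensor_lift2 y z.
Proof. exact: (tensor_liftD (balanced2_outer z)). Qed.

Lemma tensor_lift2_pure a b c d :
  tensor_lift2 (pure a b) (pure c d) = f a b c d.
Proof.
rewrite /tensor_lift2 (tensor_lift_pure (balanced2_outer _)).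
by rewrite tensor_lift_pure //; case: fB.
Qed.

Lemma tensor_lift20l z : tensor_lift2 0 z = 0.
Proof. exact: (tensor_lift0 (balanced2_outer z)). Qed.

Lemma tensor_lift2Dr x y z :
  tensor_lift2 x (y + z) = tensor_lift2 x y + tensor_lift2 x z.
Proof.
elim/tensor_ind: x => [|x x' IHx IHx'|a b].
- by rewrite !tensor_lift20l addr0.
- by rewrite !tensor_lift2Dl IHx IHx' addrACA.
- rewrite /tensor_lift2 !(tensor_lift_pure (balanced2_outer _)).
  by rewrite tensor_liftD //; case: fB.
Qed.

Lemma tensor_lift20r x : tensor_lift2 x 0 = 0.
Proof.
by apply: (addrI (tensor_lift2 x 0)); rewrite -tensor_lift2Dr !addr0.
Qed.

End Lift2.

Definition tensor_scale (k : K) : tensor -> tensor :=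
  tensor_lift (fun a b => pure (pzscale k a) b).

(* (a (x) b) (c (x) d) = ac (x) bd *)
Definition tensor_mul : tensor -> tensor -> tensor :=
  tensor_lift2 (fun a b c d => pure (a * c) (b * d)).

(* {a (x) b, c (x) d} = {a, c} (x) bd + ac (x) {b, d} *)
Definition tensor_bracket : tensor -> tensor -> tensor :=
  tensor_lift2
    (fun a b c d => pure {[a, c]} (b * d) + pure (a * c) {[b, d]}).

Lemma tensor_scale_balanced k : balanced (fun a b => pure (pzscale k a) b).
Proof.
split=> *; rewrite ?pzscaleDr ?pureDl ?pureDr // -pureZ.
by rewrite !pzscaleA [X in pzscale X]mulrC.
Qed.

Lemma tensor_mul_balanced : balanced2 (fun a b c d => pure (a * c) (b * d)).
Proof.
split=> *; split=> *.
- by rewrite mulrDr pureDl.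
- by rewrite mulrDr pureDr.
- by rewrite -!pzscaleAr pureZ.
- by rewrite mulrDl pureDl.
- by rewrite mulrDl pureDr.
- by rewrite -!pzscaleAl pureZ.
Qed.

Lemma tensor_bracket_balanced : balanced2
  (fun a b c d => pure {[a, c]} (b * d) + pure (a * c) {[b, d]}).
Proof.
split=> *; split=> *.
- by rewrite mulrDr bracketDr !pureDl addrACA.
- by rewrite mulrDr bracketDr !pureDr addrACA.
- by rewrite !bracketZr -!pzscaleAr !pureZ.
- by rewrite mulrDl bracketDl !pureDl addrACA.
- by rewrite mulrDl bracketDl !pureDr addrACA.
- by rewrite !bracketZl -!pzscaleAl !pureZ.
Qed.

Lemma tensor_mul_pure a b c d :
  tensor_mul (pure a b) (pure c d) = pure (a * c) (b * d).
Proof. exact: (tensor_lift2_pure tensor_mul_balanced). Qed.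

Let tmulDl : left_distributive tensor_mul +%R.
Proof. by move=> x y z; apply: (tensor_lift2Dl tensor_mul_balanced). Qed.
Let tmulDr : right_distributive tensor_mul +%R.
Proof. by move=> x y z; apply: (tensor_lift2Dr tensor_mul_balanced). Qed.
Let tmul0l x : tensor_mul 0 x = 0.
Proof. exact: (tensor_lift20l tensor_mul_balanced). Qed.
Let tmul0r x : tensor_mul x 0 = 0.
Proof. exact: (tensor_lift20r tensor_mul_balanced). Qed.

Lemma tensor_mulC : commutative tensor_mul.
Proof.
move=> x y; elim/tensor_ind: x => [|x x' IHx IHx'|a b].
- by rewrite tmul0l tmul0r.
- by rewrite tmulDl tmulDr IHx IHx'.
elim/tensor_ind: y => [|y y' IHy IHy'|c d].
- by rewrite tmul0l tmul0r.
- by rewrite tmulDl tmulDr IHy IHy'.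
by rewrite !tensor_mul_pure ![_ * c]mulrC ![_ * d]mulrC.
Qed.

Lemma tensor_mulA : associative tensor_mul.
Proof.
move=> x y z; elim/tensor_ind: x => [|x x' IHx IHx'|a b].
- by rewrite !tmul0l.
- by rewrite !tmulDl IHx IHx'.
elim/tensor_ind: y => [|y y' IHy IHy'|c d].
- by rewrite !(tmul0l, tmul0r).
- by rewrite !(tmulDl, tmulDr) IHy IHy'.
elim/tensor_ind: z => [|z z' IHz IHz'|e f].
- by rewrite !(tmul0l, tmul0r).
- by rewrite !(tmulDl, tmulDr) IHz IHz'.
by rewrite !tensor_mul_pure !mulrA.
Qed.

Lemma tensor_mul1 : left_id (pure 1 1) tensor_mul.
Proof.
move=> x; elim/tensor_ind: x => [|x x' IHx IHx'|a b].
- by rewrite tmul0r.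
- by rewrite tmulDr IHx IHx'.
by rewrite tensor_mul_pure !mul1r.
Qed.

HB.instance Definition _ := GRing.Zmodule_isComPzRing.Build tensor
  tensor_mulA tensor_mulC tensor_mul1 tmulDl.

Lemma mul_pure a b c d : pure a b * pure c d = pure (a * c) (b * d).
Proof. exact: tensor_mul_pure. Qed.

Lemma tensor_scale_pure k a b :
  tensor_scale k (pure a b) = pure (pzscale k a) b.
Proof. exact: (tensor_lift_pure (tensor_scale_balanced k)). Qed.

Lemma tensor_scaleDr k x y :
  tensor_scale k (x + y) = tensor_scale k x + tensor_scale k y.
Proof. exact: (tensor_liftD (tensor_scale_balanced k)). Qed.

Let scale0 k : tensor_scale k 0 = 0.
Proof. exact: (tensor_lift0 (tensor_scale_balanced k)). Qed.

Lemma tensor_scaleA k l x :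
  tensor_scale k (tensor_scale l x) = tensor_scale (k * l) x.
Proof.
elim/tensor_ind: x => [|x y IHx IHy|a b]; first by rewrite !scale0.
  by rewrite !tensor_scaleDr IHx IHy.
by rewrite !tensor_scale_pure pzscaleA.
Qed.

Lemma tensor_scale1 x : tensor_scale 1 x = x.
Proof.
elim/tensor_ind: x => [|x y IHx IHy|a b]; first by rewrite !scale0.
  by rewrite !tensor_scaleDr IHx IHy.
by rewrite !tensor_scale_pure pzscale1.
Qed.

Lemma tensor_scaleDl k l x :
  tensor_scale (k + l) x = tensor_scale k x + tensor_scale l x.
Proof.
elim/tensor_ind: x => [|x y IHx IHy|a b]; first by rewrite !scale0 addr0.
  by rewrite !tensor_scaleDr IHx IHy addrACA.
by rewrite !tensor_scale_pure pzscaleDl pureDl.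
Qed.

Lemma tensor_scaleAl k x y : tensor_scale k (x * y) = tensor_scale k x * y.
Proof.
elim/tensor_ind: x => [|x x' IHx IHx'|a b].
- by rewrite !(scale0, mul0r).
- by rewrite mulrDl !tensor_scaleDr IHx IHx' mulrDl.
elim/tensor_ind: y => [|y y' IHy IHy'|c d].
- by rewrite !(scale0, mulr0).
- by rewrite !mulrDr tensor_scaleDr IHy IHy'.
by rewrite mul_pure !tensor_scale_pure mul_pure pzscaleAl.
Qed.

HB.instance Definition _ := ComPzRing_isAlgebra.Build K tensor
  tensor_scaleA tensor_scale1 tensor_scaleDr tensor_scaleDl tensor_scaleAl.

Local Notation br := tensor_bracket.

Let br_pure a b c d :
  br (pure a b) (pure c d) = pure {[a, c]} (b * d) + pure (a * c) {[b, d]}.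
Proof. exact: (tensor_lift2_pure tensor_bracket_balanced). Qed.

Lemma tensor_bracketDl x y z : br (x + y) z = br x z + br y z.
Proof. exact: (tensor_lift2Dl tensor_bracket_balanced). Qed.

Lemma tensor_bracketDr x y z : br x (y + z) = br x y + br x z.
Proof. exact: (tensor_lift2Dr tensor_bracket_balanced). Qed.

Let br0l x : br 0 x = 0.
Proof. exact: (tensor_lift20l tensor_bracket_balanced). Qed.
Let br0r x : br x 0 = 0.
Proof. exact: (tensor_lift20r tensor_bracket_balanced). Qed.

Let brC x y : br x y = - br y x.
Proof.
elim/tensor_ind: x => [|x x' IHx IHx'|a b].
- by rewrite br0l br0r oppr0.
- by rewrite tensor_bracketDl tensor_bracketDr IHx IHx' opprD.
elim/tensor_ind: y => [|y y' IHy IHy'|c d].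
- by rewrite br0l br0r oppr0.
- by rewrite tensor_bracketDl tensor_bracketDr IHy IHy' opprD.
rewrite !br_pure opprD -pureNl -pureNr -!bracketC.
by rewrite ![_ * a]mulrC ![_ * b]mulrC.
Qed.

Lemma tensor_bracketxx x : br x x = 0.
Proof.
elim/tensor_ind: x => [|x x' IHx IHx'|a b]; first by rewrite br0l.
  rewrite tensor_bracketDl !tensor_bracketDr IHx IHx' add0r addr0.
  by rewrite brC addNr.
by rewrite br_pure !bracketxx pure0l pure0r addr0.
Qed.

Lemma tensor_bracketZl k x y :
  br (tensor_scale k x) y = tensor_scale k (br x y).
Proof.
elim/tensor_ind: x => [|x x' IHx IHx'|a b].
- by rewrite !(scale0, br0l).
- by rewrite tensor_scaleDr !tensor_bracketDl tensor_scaleDr IHx IHx'.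
elim/tensor_ind: y => [|y y' IHy IHy'|c d].
- by rewrite !(scale0, br0r).
- by rewrite !tensor_bracketDr tensor_scaleDr IHy IHy'.
rewrite tensor_scale_pure !br_pure tensor_scaleDr !tensor_scale_pure.
by rewrite bracketZl pzscaleAl.
Qed.

Lemma tensor_bracketZr k x y :
  br x (tensor_scale k y) = tensor_scale k (br x y).
Proof.
have scaleN z : tensor_scale k (- z) = - tensor_scale k z.
  by apply: (addrI (tensor_scale k z)); rewrite -tensor_scaleDr !subrr scale0.
by rewrite brC tensor_bracketZl -scaleN -brC.
Qed.

Lemma tensor_bracket_leibniz x y z : br x (y * z) = br x y * z + y * br x z.
Proof.
elim/tensor_ind: x => [|x x' IHx IHx'|a b].
- by rewrite !br0l mul0r mulr0 addr0.
- by rewrite !tensor_bracketDl IHx IHx' mulrDl mulrDr addrACA.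
elim/tensor_ind: y => [|y y' IHy IHy'|c d].
- by rewrite !(br0r, mul0r) addr0.
- by rewrite mulrDl !tensor_bracketDr IHy IHy' !mulrDl addrACA.
elim/tensor_ind: z => [|z z' IHz IHz'|e f].
- by rewrite !(br0r, mulr0) addr0.
- by rewrite mulrDr !tensor_bracketDr IHz IHz' !mulrDr addrACA.
rewrite mul_pure !br_pure mulrDl mulrDr !mul_pure !bracket_leibniz.
rewrite pureDl pureDr [RHS]addrACA; congr (_ + _ + (_ + _)).
- by rewrite mulrA.
- by rewrite [b * (d * f)]mulrCA.
- by rewrite mulrA.
- by rewrite [a * (c * e)]mulrCA.
Qed.

Lemma tensor_bracket_jacobi x y z :
  br x (br y z) + br y (br z x) + br z (br x y) = 0.
Proof.
have add3 (p p' q q' r r' : tensor) : p + q + r = 0 -> p' + q' + r' = 0 ->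
    (p + p') + (q + q') + (r + r') = 0.
  by move=> e e'; rewrite [p + p' + (q + q')]addrACA [LHS]addrACA e e' addr0.
elim/tensor_ind: x => [|x x' IHx IHx'|a b].
- by rewrite !(br0l, br0r) !addr0.
- by rewrite !(tensor_bracketDl, tensor_bracketDr); apply: add3.
elim/tensor_ind: y => [|y y' IHy IHy'|c d].
- by rewrite !(br0l, br0r) !addr0.
- by rewrite !(tensor_bracketDl, tensor_bracketDr); apply: add3.
elim/tensor_ind: z => [|z z' IHz IHz'|e f].
- by rewrite !(br0l, br0r) !addr0.
- by rewrite !(tensor_bracketDl, tensor_bracketDr); apply: add3.
pose U a1 a2 a3 b1 b2 b3 := pure (a1 * {[a2, a3]}) (b1 * {[b2, b3]}).
have expand a1 b1 a2 b2 a3 b3 :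
    br (pure a1 b1) (br (pure a2 b2) (pure a3 b3)) =
    (pure {[a1, {[a2, a3]}]} (b1 * b2 * b3)
       + pure (a1 * a2 * a3) {[b1, {[b2, b3]}]})
    + ((U a1 a2 a3 b3 b1 b2 - U a1 a2 a3 b2 b3 b1)
       + (U a3 a1 a2 b1 b2 b3 - U a2 a3 a1 b1 b2 b3)).
  rewrite /U [br (pure a2 b2) _]br_pure tensor_bracketDr !br_pure.
  rewrite !bracket_leibniz !pureDl !pureDr !mulrA.
  rewrite [{[b1, b2]} * b3]mulrC [{[a1, a2]} * a3]mulrC.
  rewrite (bracketC a3 a1) (bracketC b3 b1) !mulrN pureNl pureNr !opprK.
  by rewrite [X in _ + X]addrC addrACA.
rewrite !expand; apply: (add3).
  rewrite [c * e * a]mulrC [d * f * b]mulrC ![e * a * _]mulrC ![f * b * _]mulrC.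
  rewrite !mulrA; apply: (add3).
    by rewrite [d * f * b]mulrC mulrA -!pureDl bracket_jacobi pure0l.
  by rewrite [c * e * a]mulrC mulrA -!pureDr bracket_jacobi pure0r.
have tele (p q r : tensor) : p - q + (q - r) = p - r by rewrite addrA subrK.
move: (U a c e f b d) (U a c e d f b) (U e a c b d f) => p1 p2 p3.
move: (U c e a b d f) (U c e a f b d) (U e a c d f b) => p4 p5 p6.
rewrite [p4 - p5 + _]addrC [p1 - p2 + _ + _]addrACA !tele.
by rewrite [LHS]addrACA !tele subrr.
Qed.

HB.instance Definition _ := ComPzAlgebra_isPoisson.Build K tensor
  tensor_bracketDl tensor_bracketDr tensor_bracketZl tensor_bracketZr
  tensor_bracketxx tensor_bracket_jacobi tensor_bracket_leibniz.

Lemma bracket_pure a b c d :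
  {[pure a b, pure c d]} = pure {[a, c]} (b * d) + pure (a * c) {[b, d]}.
Proof. exact: br_pure. Qed.

End Tensor.

Notation "A \ox B" := (tensor A B) (at level 40, left associativity) : type_scope.
Notation "a \ot b" := (pure a b) (at level 40, left associativity) : ring_scope.

Section KahlerPoisson.
Variables (K : fieldType) (A : poissonAlgType K) (m : nat).
Implicit Types (g : 'M[A]_m) (x : 'I_m -> A).

Definition kahler_poisson_eq g x (eta : A) : Prop := forall a b : A,
  \sum_(i < m) \sum_(j < m) \sum_(k < m) \sum_(l < m)
    eta * {[a, x i]} * g i j * {[x j, x k]} * g k l * {[x l, b]}
  = - {[a, b]}.

Definition kahler_poisson g x : Prop :=
  g^T = g /\ exists eta : A, kahler_poisson_eq g x eta.

End KahlerPoisson.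

Section TensorKahlerPoisson.
Variables (K : fieldType) (A A' : poissonAlgType K) (m m' : nat).

Definition tensor_gen (x : 'I_m -> A) (y : 'I_m' -> A') :
    'I_(m + m') -> A \ox A' :=
  fun I => match split I with
           | inl i => x i \ot 1
           | inr j => 1 \ot y j
           end.

Definition tensor_metric (rho : A) (rho' : A') (g : 'M[A]_m) (g' : 'M[A']_m') :
    'M[A \ox A']_(m + m') :=
  block_mx (\matrix_(i, j) ((rho * g i j) \ot 1)) 0
           0 (\matrix_(i, j) (1 \ot (rho' * g' i j))).

End TensorKahlerPoisson.

(* Main.v *)
Require Import Defs.
From HB Require Import structures.
From mathcomp Require Import all_boot all_order all_algebra.
From mathcomp Require Import reals.
Import GRing.Theory.
Local Open Scope ring_scope.

(** The left-hand side of the Kähler-Poisson identity is [eta] times a matrix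
    product [U g P g V], where [U] is the row of the brackets [{a, x^i}], [P] the
    matrix of the brackets [{x^j, x^k}] and [V] the column of the brackets
    [{x^l, b}]; call that product [kform g x a b].  It is biadditive in [a] and
    [b], and multiplying [g] by [rho] multiplies it by [rho ^+ 2].

    In the tensor product, [{x^i (x) 1, 1 (x) y^j} = 0], so [P] is block diagonal
    for the combined generators, like the metric; hence [kform] is the sum of
    the forms of the two blocks ([kform_block]).  On pure tensors, bracketing
    [a (x) b] with [x^i (x) 1] gives [{a, x^i} (x) b]: up to the factor
    [1 (x) b], this is the image of [{a, x^i}] under the ring morphism
    [a |-> a (x) 1].  Therefore ([kform_morph]) the first block contributes
    [rho ^+ 2 * kform g x a c (x) b * d = - {a, c} (x) b * d], and the second
    one [- a * c (x) {b, d}].  Their sum is [- {a (x) b, c (x) d}], so the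
    identity holds with [eta = 1]: the square roots of [eta] and [eta'] are
    absorbed in the metric, which occurs twice in each term, because a factor in
    front of the sum multiplies both blocks alike. *)

(** * The Kähler-Poisson identity as a matrix product *)

Section KForm.
Context {K : fieldType} {A : poissonAlgType K}.

Definition bracket_row {m} (a : A) (x : 'I_m -> A) : 'rV[A]_m :=
  \row_i {[a, x i]}.
Definition bracket_col {m} (x : 'I_m -> A) (b : A) : 'cV[A]_m :=
  \col_i {[x i, b]}.
Definition bracket_mx {m} (x : 'I_m -> A) : 'M[A]_m :=
  \matrix_(i, j) {[x i, x j]}.

Definition kform {m} (g : 'M[A]_m) (x : 'I_m -> A) (a b : A) : A :=
  (bracket_row a x *m g *m bracket_mx x *m g *m bracket_col x b) 0 0.

Lemma kahler_poisson_eqP m (g : 'M[A]_m) (x : 'I_m -> A) (eta : A) :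
  kahler_poisson_eq g x eta <->
  forall a b, eta * kform g x a b = - {[a, b]}.
Proof.
suff kformE a b : \sum_(i < m) \sum_(j < m) \sum_(k < m) \sum_(l < m)
    eta * {[a, x i]} * g i j * {[x j, x k]} * g k l * {[x l, b]}
    = eta * kform g x a b.
  by split=> h a b; have := h a b; rewrite kformE.
(* The matrix product unfolds with its summation indices in reverse order. *)
rewrite /kform mxE mulr_sumr.
under [RHS]eq_bigr => l _.
  rewrite !mxE mulr_suml mulr_sumr.
  under eq_bigr => k _.
    rewrite !mxE !mulr_suml mulr_sumr.
    under eq_bigr => j _.
      rewrite !mxE !mulr_suml mulr_sumr.
      under eq_bigr => i _ do rewrite !mxE !mulrA.
      over.
    over.
  over.
rewrite /=.
under eq_bigr => i _ do under eq_bigr => j _ do rewrite exchange_big.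
under eq_bigr => i _ do rewrite exchange_big.
rewrite exchange_big; apply: eq_bigr => l _.
under eq_bigr => i _ do rewrite exchange_big.
rewrite exchange_big; apply: eq_bigr => k _.
by rewrite exchange_big.
Qed.

Lemma kformDl m (g : 'M[A]_m) x a a' b :
  kform g x (a + a') b = kform g x a b + kform g x a' b.
Proof.
rewrite /kform.
have -> : bracket_row (a + a') x = bracket_row a x + bracket_row a' x.
  by apply/rowP => i; rewrite !mxE bracketDl.
by rewrite !mulmxDl mxE.
Qed.

Lemma kformDr m (g : 'M[A]_m) x a b b' :
  kform g x a (b + b') = kform g x a b + kform g x a b'.
Proof.
rewrite /kform.
have -> : bracket_col x (b + b') = bracket_col x b + bracket_col x b'.
  by apply/colP => i; rewrite !mxE bracketDr.
by rewrite mulmxDr mxE.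
Qed.

Lemma kform0l m (g : 'M[A]_m) x b : kform g x 0 b = 0.
Proof. by apply: (addrI (kform g x 0 b)); rewrite -kformDl !addr0. Qed.

Lemma kform0r m (g : 'M[A]_m) x a : kform g x a 0 = 0.
Proof. by apply: (addrI (kform g x a 0)); rewrite -kformDr !addr0. Qed.

Lemma kform_scale m (g : 'M[A]_m) x r a b :
  kform (r *: g) x a b = r ^+ 2 * kform g x a b.
Proof. by rewrite /kform -!(scalemxAl, scalemxAr) scalerA mxE expr2. Qed.

(** When the two families of generators Poisson-commute, the bracket matrix of
    their concatenation is block diagonal, so a block diagonal metric makes the
    form split. *)
Lemma kform_block m n (g : 'M[A]_m) (h : 'M[A]_n)
    (x : 'I_m -> A) (y : 'I_n -> A) a b :
  (forall i j, {[x i, y j]} = 0) ->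
  kform (block_mx g 0 0 h)
    (fun I => match split I with inl i => x i | inr j => y j end) a b
  = kform g x a b + kform h y a b.
Proof.
move=> xy0; set z := fun I => _.
have zl i : z (lshift n i) = x i by rewrite /z (unsplitK (inl i)).
have zr j : z (rshift m j) = y j by rewrite /z (unsplitK (inr j)).
rewrite /kform.
have -> : bracket_row a z = row_mx (bracket_row a x) (bracket_row a y).
  apply/rowP => I; rewrite -[I]splitK; case: (split I) => i /=;
  by rewrite mxE ?row_mxEl ?row_mxEr ?zl ?zr mxE.
have -> : bracket_col z b = col_mx (bracket_col x b) (bracket_col y b).
  apply/colP => I; rewrite -[I]splitK; case: (split I) => i /=;
  by rewrite mxE ?col_mxEu ?col_mxEd ?zl ?zr mxE.
have -> : bracket_mx z = block_mx (bracket_mx x) 0 0 (bracket_mx y).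
  apply/matrixP => I J; rewrite -[I]splitK -[J]splitK.
  case: (split I) => i; case: (split J) => j /=; rewrite mxE ?zl ?zr.
  - by rewrite block_mxEul mxE.
  - by rewrite block_mxEur mxE.
  - by rewrite block_mxEdl mxE bracketC xy0 oppr0.
  - by rewrite block_mxEdr mxE.
rewrite !mul_row_block !mulmx0 !addr0 !add0r.
by rewrite mul_row_col mxE.
Qed.

End KForm.

(** Bracketing [u] with the image under [f] need not land in the image of [f]:
    in the tensor product the bracket of [a (x) b] with [x (x) 1] is
    [{a, x} (x) b].  The scalars [s] and [t] absorb this discrepancy. *)
Lemma kform_morph (K : fieldType) (A B : poissonAlgType K)
    (f : {rmorphism A -> B}) m (g : 'M[A]_m) (x : 'I_m -> A)
    (a c : A) (u v s t : B) :
  (forall p q, {[f p, f q]} = f {[p, q]}) ->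
  (forall p, {[u, f p]} = s * f {[a, p]}) ->
  (forall p, {[f p, v]} = t * f {[p, c]}) ->
  kform (map_mx f g) (f \o x) u v = s * t * f (kform g x a c).
Proof.
move=> fb fu fv; rewrite /kform.
have -> : bracket_row u (f \o x) = s *: map_mx f (bracket_row a x).
  by apply/rowP => i; rewrite !mxE /= fu.
have -> : bracket_col (f \o x) v = t *: map_mx f (bracket_col x c).
  by apply/colP => i; rewrite !mxE /= fv.
have -> : bracket_mx (f \o x) = map_mx f (bracket_mx x).
  by apply/matrixP => i j; rewrite !mxE /= fb.
rewrite -scalemxAr -!scalemxAl scalerA -!map_mxM.
by rewrite mxE [map_mx _ _ _ _]mxE [t * s]mulrC.
Qed.

(** * The two embeddings into the tensor product *)

Section Embeddings.
Variables (K : fieldType) (A B : poissonAlgType K).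

Definition tensor_inl (a : A) : A \ox B := a \ot 1.
Definition tensor_inr (b : B) : A \ox B := 1 \ot b.

Fact tensor_inl_additive : zmod_morphism tensor_inl.
Proof. by move=> a a'; rewrite /tensor_inl pureDl pureNl. Qed.
Fact tensor_inl_monoid : monoid_morphism tensor_inl.
Proof. by split=> // a a'; rewrite /tensor_inl mul_pure mulr1. Qed.
HB.instance Definition _ :=
  GRing.isZmodMorphism.Build A (A \ox B) tensor_inl tensor_inl_additive.
HB.instance Definition _ :=
  GRing.isMonoidMorphism.Build A (A \ox B) tensor_inl tensor_inl_monoid.

Fact tensor_inr_additive : zmod_morphism tensor_inr.
Proof. by move=> b b'; rewrite /tensor_inr pureDr pureNr. Qed.
Fact tensor_inr_monoid : monoid_morphism tensor_inr.
Proof. by split=> // b b'; rewrite /tensor_inr mul_pure mulr1. Qed.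
HB.instance Definition _ :=
  GRing.isZmodMorphism.Build B (A \ox B) tensor_inr tensor_inr_additive.
HB.instance Definition _ :=
  GRing.isMonoidMorphism.Build B (A \ox B) tensor_inr tensor_inr_monoid.

Lemma kform_inl m (g : 'M[A]_m) (x : 'I_m -> A) a b c d :
  kform (map_mx tensor_inl g) (tensor_inl \o x) (a \ot b) (c \ot d)
  = kform g x a c \ot (b * d).
Proof.
rewrite (@kform_morph _ _ _ tensor_inl _ _ _ a c _ _ (1 \ot b) (1 \ot d)).
- by rewrite /tensor_inl !mul_pure !mul1r mulr1.
- by move=> p q; rewrite /tensor_inl bracket_pure bracketxx pure0r addr0 mulr1.
- move=> p; rewrite /tensor_inl bracket_pure bracketr1 pure0r addr0.
  by rewrite mul_pure mul1r.
- move=> p; rewrite /tensor_inl bracket_pure bracket1r pure0r addr0.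
  by rewrite mul_pure !mul1r mulr1.
Qed.

Lemma kform_inr m (g : 'M[B]_m) (y : 'I_m -> B) a b c d :
  kform (map_mx tensor_inr g) (tensor_inr \o y) (a \ot b) (c \ot d)
  = (a * c) \ot kform g y b d.
Proof.
rewrite (@kform_morph _ _ _ tensor_inr _ _ _ b d _ _ (a \ot 1) (c \ot 1)).
- by rewrite /tensor_inr !mul_pure !mul1r mulr1.
- by move=> p q; rewrite /tensor_inr bracket_pure bracketxx pure0l add0r mulr1.
- move=> p; rewrite /tensor_inr bracket_pure bracketr1 pure0l add0r.
  by rewrite mul_pure mul1r.
- move=> p; rewrite /tensor_inr bracket_pure bracket1r pure0l add0r.
  by rewrite mul_pure !mul1r mulr1.
Qed.

Lemma bracket_inl_inr a b : {[tensor_inl a, tensor_inr b]} = 0.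
Proof.
by rewrite bracket_pure bracketr1 bracket1r pure0l pure0r addr0.
Qed.

Lemma tensor_metricE m n rho rho' (g : 'M[A]_m) (g' : 'M[B]_n) :
  tensor_metric rho rho' g g' =
  block_mx (map_mx tensor_inl (rho *: g)) 0 0 (map_mx tensor_inr (rho' *: g')).
Proof.
by rewrite /tensor_metric; congr block_mx; apply/matrixP => i j; rewrite !mxE.
Qed.

Lemma tensor_metric_sym m n rho rho' (g : 'M[A]_m) (g' : 'M[B]_n) :
  g^T = g -> g'^T = g' ->
  (tensor_metric rho rho' g g')^T = tensor_metric rho rho' g g'.
Proof.
move=> gT gT'; rewrite tensor_metricE tr_block_mx !trmx0.
by rewrite !map_trmx !linearZ /= gT gT'.
Qed.

End Embeddings.

(** * The tensor product of Kähler-Poisson algebras *)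

Theorem proposition5p6 (R : realType) (c : bool)
    (A A' : poissonAlgType (scalars R c)) (m m' : nat)
    (g : 'M[A]_m) (x : 'I_m -> A) (g' : 'M[A']_m') (y : 'I_m' -> A')
    (hK : kahler_poisson g x) (hK' : kahler_poisson g' y)
    (eta : A) (eta' : A')
    (heta : kahler_poisson_eq g x eta) (heta' : kahler_poisson_eq g' y eta')
    (rho : A) (rho' : A') (hrho : rho ^+ 2 = eta) (hrho' : rho' ^+ 2 = eta') :
  kahler_poisson (tensor_metric rho rho' g g') (tensor_gen x y).
Proof.
split; first exact: tensor_metric_sym (proj1 hK) (proj1 hK').
exists 1; apply/kahler_poisson_eqP => u v; rewrite mul1r.
elim/tensor_ind: u => [|u u' IHu IHu'|a b].
- by rewrite kform0l bracket0r oppr0.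
- by rewrite kformDl bracketDl opprD IHu IHu'.
elim/tensor_ind: v => [|v v' IHv IHv'|a' b'].
- by rewrite kform0r bracketr0 oppr0.
- by rewrite kformDr bracketDr opprD IHv IHv'.
rewrite tensor_metricE.
rewrite (@kform_block _ _ _ _ _ _ (@tensor_inl _ A A' \o x)
  (@tensor_inr _ A A' \o y)); last by move=> i j; apply: bracket_inl_inr.
rewrite kform_inl kform_inr !kform_scale hrho hrho'.
move/kahler_poisson_eqP: heta => ->; move/kahler_poisson_eqP: heta' => ->.
by rewrite bracket_pure pureNl pureNr opprD.
Qed.
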